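(* Let $\theta\in(0,\frac{\pi}{2})$ and let $\psi$ be an eigenvector of $\Delta^{\mathsf{Dir}}_{\Omega_\theta}$ associated with an eigenvalue $\lambda<1$. Then $\psi$ is even with respect to $x_2$, i.e. $\psi(x_1,-x_2)=\psi(x_1,x_2)$ for almost every $(x_1,x_2)\in\Omega_\theta$.
   Context: For $\theta\in(0,\frac{\pi}{2})$ the broken guide is $$\Omega_\theta=\Big\{(x_1,x_2)\in\mathbb{R}^2:\ x_1\tan\theta<|x_2|<\Big(x_1+\frac{\pi}{\sin\theta}\Big)\tan\theta\Big\},$$ which is symmetric with respect to the $x_1$ axis. $\Delta^{\mathsf{Dir}}_{\Omega_\theta}$ denotes the positive Dirichlet Laplacian on $\Omega_\theta$: the self-adjoint operator $\psi\mapsto-\Delta\psi$ on $L^2(\Omega_\theta)$ with domain $\{\psi\in H^1_0(\Omega_\theta):\ \Delta\psi\in L^2(\Omega_\theta)\}$. *)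

(* Defs.v *)
From HB Require Import structures.
From mathcomp Require Import all_boot all_order all_algebra.
From mathcomp Require Import all_classical all_reals all_analysis.
From mathcomp Require Export complex.

Set Implicit Arguments.
Unset Strict Implicit.
Unset Printing Implicit Defensive.

Import Order.TTheory GRing.Theory Num.Theory.
Import numFieldNormedType.Exports.

Local Open Scope classical_set_scope.
Local Open Scope ring_scope.

Definition plane_measure (R : realType) :
    {measure set (measurableTypeR R * measurableTypeR R)%type -> \bar R} :=
  (@lebesgue_measure R \x @lebesgue_measure R)%E.

Definition e1 (R : realType) : R * R := (1, 0).
Definition e2 (R : realType) : R * R := (0, 1).

Definition broken_guide (R : realType) (theta : R) : set (R * R) :=
  [set x | x.1 * tan theta < `|x.2| < (x.1 + pi / sin theta) * tan theta].

(* [R[i]] carries no measurable or normed [R]-module structure in the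
   libraries: measurability, derivatives and integrals of complex-valued
   functions are taken on real and imaginary parts. *)
Definition cderive (R : realType) (v : R * R) (u : R * R -> R[i]) :
    R * R -> R[i] :=
  fun x => Complex ('D_v (fun y => complex.Re (u y)) x)
                   ('D_v (fun y => complex.Im (u y)) x).

Definition claplacian (R : realType) (u : R * R -> R[i]) : R * R -> R[i] :=
  fun x => cderive (e1 R) (cderive (e1 R) u) x
           + cderive (e2 R) (cderive (e2 R) u) x.

Definition cintegral (R : realType) (U : set (R * R)) (u : R * R -> R[i]) :
    R[i] :=
  Complex (Rintegral (@plane_measure R) U (fun x => complex.Re (u x)))
          (Rintegral (@plane_measure R) U (fun x => complex.Im (u x))).

Definition sq_L2norm (R : realType) (U : set (R * R)) (u : R * R -> R[i]) :
    \bar R :=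
  (\int[@plane_measure R]_(x in U)
     (complex.Re (u x) ^+ 2 + complex.Im (u x) ^+ 2)%:E)%E.

(* Elements of function spaces on [U] are represented by functions on the whole
   plane whose values outside [U] are irrelevant. *)
Definition in_L2 (R : realType) (U : set (R * R)) (u : R * R -> R[i]) : Prop :=
  [/\ measurable_fun U (fun x => complex.Re (u x)),
      measurable_fun U (fun x => complex.Im (u x)) &
      (sq_L2norm U u < +oo)%E].

Fixpoint continuously_differentiable (R : realType) (n : nat)
    (f : R * R -> R) : Prop :=
  continuous f /\
  if n is m.+1 then
    [/\ forall x, derivable f x (e1 R) /\ derivable f x (e2 R),
        continuously_differentiable m ('D_(e1 R) f) &
        continuously_differentiable m ('D_(e2 R) f)]
  else True.

Definition test_function (R : realType) (U : set (R * R))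
    (phi : R * R -> R[i]) : Prop :=
  [/\ forall n, continuously_differentiable n (fun x => complex.Re (phi x)),
      forall n, continuously_differentiable n (fun x => complex.Im (phi x)),
      compact (closure [set x | phi x != 0]) &
      closure [set x | phi x != 0] `<=` U].

Definition weak_derivative (R : realType) (U : set (R * R)) (v : R * R)
    (u g : R * R -> R[i]) : Prop :=
  forall phi, test_function U phi ->
    cintegral U (fun x => u x * cderive v phi x)
    = - cintegral U (fun x => g x * phi x).

(* The closure of the test functions in H^1(U); [g1] and [g2] are the weak
   first-order derivatives of [u]. *)
Definition in_H10 (R : realType) (U : set (R * R)) (u : R * R -> R[i]) : Prop :=
  exists g1 g2 : R * R -> R[i],
    [/\ [/\ in_L2 U u, in_L2 U g1 & in_L2 U g2],
        weak_derivative U (e1 R) u g1,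
        weak_derivative U (e2 R) u g2 &
        forall eps : R, 0 < eps -> exists2 phi, test_function U phi &
          (sq_L2norm U (fun x => (phi x - u x)%R)
           + sq_L2norm U (fun x => (cderive (e1 R) phi x - g1 x)%R)
           + sq_L2norm U (fun x => (cderive (e2 R) phi x - g2 x)%R)
           < (eps ^+ 2)%:E)%E].

Definition weak_laplacian (R : realType) (U : set (R * R))
    (u g : R * R -> R[i]) : Prop :=
  forall phi, test_function U phi ->
    cintegral U (fun x => u x * claplacian phi x)
    = cintegral U (fun x => g x * phi x).

(* The graph of the positive Dirichlet Laplacian: [u] is in its domain and
   [f = - Delta u] as distributions. *)
Definition dirichlet_laplacian (R : realType) (U : set (R * R))
    (u f : R * R -> R[i]) : Prop :=
  [/\ in_H10 U u, in_L2 U f & weak_laplacian U u (fun x => - f x)].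

Definition dirichlet_eigenvector (R : realType) (U : set (R * R)) (lambda : R)
    (psi : R * R -> R[i]) : Prop :=
  ~ {ae @plane_measure R, forall x, U x -> psi x = 0} /\
  dirichlet_laplacian U psi (fun x => real_complex R lambda * psi x).

(* Main.v *)
From HB Require Import structures.
Require Import Defs.
From mathcomp Require Import all_boot all_order all_algebra.
From mathcomp Require Import all_classical all_reals all_analysis.
From mathcomp Require Import measurable_realfun ring lra.

Set Implicit Arguments.
Unset Strict Implicit.
Unset Printing Implicit Defensive.

Import Order.TTheory GRing.Theory Num.Theory.
Import numFieldNormedType.Exports.

Local Open Scope classical_set_scope.
Local Open Scope ring_scope.

(** Let [q] be the part of [psi] that is odd in the second variable.  On the
    upper half of the guide, a strip of width [pi] cut by the first axis, an odd
    function vanishes on the cut as well as on the edges; the lowest transverse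
    Dirichlet eigenvalue of a strip of width [pi] being 1, the energy
    [int |grad q|^2] is at least [int q^2].  The eigenvalue equation makes the
    same energy equal to [lambda int q^2], and [lambda < 1] forces [q = 0].

    The inequality ([odd_poincare]) is proved for odd test functions [chi] with
    the positive solution [w = sin t] of [- Delta w = w], where [t] is the
    distance to the lower edge of the upper strip.  Writing [chi = w (chi / w)]
    gives the pointwise bound
    [|grad chi|^2 - chi^2 >= div (chi^2 cot t n)], with [n] the unit normal of
    the strip, and the right-hand side integrates to 0 by Fubini and the
    fundamental theorem of calculus: the field vanishes near the edges, where
    [chi] does, and on the axis, by oddness.  This works slice by slice along
    the coordinate axes, without traces or rotations of the plane.

    The passage to the eigenfunction ([odd_part_eq0]) is quantitative.  If [phi]
    is a test function close to [psi] and [chi] is twice its odd part, the form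
    [E(u, v) = int grad u . grad v - lambda u v] satisfies
    [2 E(phi, chi) = E(chi, chi)], because integrals are invariant under the
    reflection, and [E(phi, chi) = E(phi - psi, chi)], because [chi] is a test
    function.  Coercivity of [E] on odd functions then bounds [int chi^2] by a
    multiple of the squared H^1 distance between [phi] and [psi].  Everything is
    done on real functions, for the real and imaginary parts of [psi] in turn
    ([weak_form_part], [real_approx]). *)

(** * Measure and reflection on the plane *)

Section PlaneMeasure.
Context {R : realType}.
Local Notation plane := (measurableTypeR R * measurableTypeR R)%type.
Local Notation mu := (@plane_measure R).
Implicit Types (f g : plane -> R) (D : set plane).

(** The plane is second countable: an open set is the union of the rational
    squares that it contains. *)
Lemma open_measurable_plane D : open (D : set (R * R)) -> measurable D.
Proof.
move=> oD.
pose box (a b r : rat) : set plane :=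
  [set x | ball (ratr a : R) (ratr r) x.1 /\ ball (ratr b : R) (ratr r) x.2].
pose S (a b r : rat) : set plane := if `[< box a b r `<=` D >] then box a b r else set0.
have -> : D = \bigcup_a \bigcup_b \bigcup_r S a b r.
  apply/seteqP; split=> [x Dx|x [a _ [b _ [r _]]]]; last first.
    by rewrite /S; case: ifPn => // /asboolP; exact.
  have /nbhs_ballP[e /= e0 eD] : nbhs x D by exact: open_nbhs_nbhs.
  have e20 : 0 < e / 2 by rewrite divr_gt0.
  have [r] := rat_in_itvoo e20.
  rewrite in_itv/= => /andP[r0 re].
  have near_rat (y : R) : exists a : rat, `|ratr a - y| < ratr r.
    have [|a] := @rat_in_itvoo _ (y - ratr r) (y + ratr r); first lra.
    by rewrite in_itv/= => ya; exists a; rewrite ltr_distl.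
  have [a xa] := near_rat x.1; have [b xb] := near_rat x.2.
  exists a => //; exists b => //; exists r => //.
  rewrite /S; case: ifPn => [_|/asboolP]; first by split.
  case => y [ya yb]; apply: eD; split; rewrite /ball/=.
    move: xa ya; rewrite /ball/=; rewrite !ltr_distl => /andP[? ?] /andP[? ?].
    by apply/andP; split; lra.
  move: xb yb; rewrite /ball/=; rewrite !ltr_distl => /andP[? ?] /andP[? ?].
  by apply/andP; split; lra.
apply: bigcupT_measurable_rat => a; apply: bigcupT_measurable_rat => b.
apply: bigcupT_measurable_rat => r; rewrite /S; case: ifPn => // _.
rewrite -[box a b r]/(ball (ratr a : R) (ratr r) `*` ball (ratr b : R) (ratr r)).
by apply: measurableX; rewrite ball_itv; exact: measurable_itv.
Qed.

Lemma continuous_measurable_plane f :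
  continuous (f : R * R -> R) -> measurable_fun setT f.
Proof.
move=> cf; apply: (measurability _ (RGenOpens.measurableE R)).
move=> _ [_ [a [b ->] <-]]; rewrite setTI; apply: open_measurable_plane.
by apply: open_comp => // ? _; exact: cf.
Qed.

Lemma integrable_addR D f g : measurable D -> mu.-integrable D (EFin \o f) ->
  mu.-integrable D (EFin \o g) ->
  mu.-integrable D (EFin \o (fun x => f x + g x)).
Proof. by move=> mD intf intg; exact: (integrableD mD intf intg). Qed.

Lemma integrable_subR D f g : measurable D -> mu.-integrable D (EFin \o f) ->
  mu.-integrable D (EFin \o g) ->
  mu.-integrable D (EFin \o (fun x => f x - g x)).
Proof. by move=> mD intf intg; exact: (integrableB mD intf intg). Qed.

Lemma integrable_mulR D (a : R) f : measurable D -> mu.-integrable D (EFin \o f) ->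
  mu.-integrable D (EFin \o (fun x => a * f x)).
Proof. by move=> mD intf; exact: (integrableZl mD a intf). Qed.

Definition square (M : R) : set plane :=
  [set` `[- M, M]] `*` [set` `[- M, M]].

Lemma integrable_continuous_square f M D : measurable D -> continuous (f : R * R -> R) ->
  (forall x, ~ square M x -> f x = 0) ->
  mu.-integrable D (EFin \o f).
Proof.
move=> mD cf f0.
have msq : measurable (square M) by apply: measurableX; exact: measurable_itv.
apply: (@integrableS _ _ _ _ setT) => //.
have -> : EFin \o f = (EFin \o f) \_ (square M).
  apply/funext => x; rewrite patchE; case: ifPn => //.
  by rewrite notin_setE => /f0 /= ->.
apply/(integrable_restrict _ msq measurableT); rewrite setTI.
apply: measurable_bounded_integrable => //.
- pose I : set R := [set` `[- M, M]].
  have -> : mu (square M) = (lebesgue_measure I * lebesgue_measure I)%E.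
    by apply: product_measure1E; exact: measurable_itv.
  rewrite !lebesgue_measure_itv/=; case: ifPn => _; last by rewrite mule0 ltry.
  by rewrite -EFinB -EFinM ltry.
- by apply: measurable_funTS; apply: continuous_measurable_plane.
- have csq : compact (square M : set (R * R)).
    by apply: compact_setX; exact: segment_compact.
  have /(continuous_compact (continuous_subspaceT cf))/compact_bounded[B [_ Bf]] := csq.
  by exists B; split; rewrite ?num_real // => ? ? ? ?; exact: Bf.
Qed.

Definition mirror (x : plane) : plane := (x.1, - x.2).

Lemma mirrorK : involutive mirror.
Proof. by case=> x y; rewrite /mirror/= opprK. Qed.

Lemma continuous_mirror : continuous (mirror : R * R -> R * R).
Proof.
move=> x; apply: (@cvg_pair _ _ _ _ (nbhs x.1) (nbhs (- x.2))).
  exact: cvg_fst.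
by apply: cvgN; exact: cvg_snd.
Qed.

Lemma measurable_mirror : measurable_fun setT mirror.
Proof.
apply: measurable_fun_pair; first exact: measurable_fst.
by apply: measurableT_comp => //; exact: measurable_snd.
Qed.

(** Both measures agree on rectangles, where this is the invariance of the
    Lebesgue measure of the line under negation. *)
Lemma plane_measure_mirror D : measurable D ->
  pushforward mu mirror D = mu D.
Proof.
move=> mD; apply/esym.
pose m : {measure set plane -> \bar R} := pushforward mu mirror.
rewrite -[RHS]/(m measurable_mirror D); apply: product_measure_unique => // A B mA mB.
rewrite /= /pushforward.
have -> : mirror @^-1` (A `*` B) = A `*` (-%R @^-1` B) by [].
rewrite /plane_measure product_measure1E//.
  by congr (_ * _)%E; exact: lebesgue_measureN.
by rewrite -[X in measurable X]setTI; exact: (@oppr_measurable R setT).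
Qed.

Section Reflection.
Variables (D : set plane).
Hypotheses (mD : measurable D) (sD : forall x, D x -> D (mirror x)).

Lemma preimage_mirror : mirror @^-1` D = D.
Proof.
apply/seteqP; split=> x /=; last exact: sD.
by move=> /sD; rewrite mirrorK.
Qed.

Lemma measurable_fun_mirror (f : plane -> R) :
  measurable_fun D f -> measurable_fun D (f \o mirror).
Proof.
move=> mf; apply: (measurable_comp mD) => //.
  by move=> _ [x Dx <-]; exact: sD.
exact: measurable_funTS measurable_mirror.
Qed.

Lemma ge0_integral_mirror (f : plane -> \bar R) :
  measurable_fun D f -> (forall x, D x -> 0 <= f x)%E ->
  (\int[mu]_(x in D) f (mirror x) =
   \int[mu]_(x in D) f x)%E.
Proof.
move=> mf f0.
transitivity (\int[pushforward mu mirror]_(y in D) f y)%E.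
  rewrite ge0_integral_pushforward//; first by rewrite preimage_mirror.
    exact: measurable_mirror.
  by move=> x; rewrite inE; exact: f0.
pose m : {measure set plane -> \bar R} := pushforward mu mirror.
apply: (eq_measure_integral mu (m1 := m measurable_mirror)) => A mA _.
exact: plane_measure_mirror.
Qed.

Lemma integral_mirror (f : plane -> \bar R) : measurable_fun D f ->
  (\int[mu]_(x in D) f (mirror x) =
   \int[mu]_(x in D) f x)%E.
Proof.
move=> mf; rewrite integralE [RHS]integralE.
rewrite (_ : (fun x => f (mirror x))^\+ = f^\+ \o mirror)%E; last exact: funepos_comp.
rewrite (_ : (fun x => f (mirror x))^\- = f^\- \o mirror)%E; last exact: funeneg_comp.
congr (_ - _)%E.
  by apply: ge0_integral_mirror => //; exact: measurable_funepos.
by apply: ge0_integral_mirror => //; exact: measurable_funeneg.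
Qed.

Lemma integrable_mirror (f : plane -> R) :
  mu.-integrable D (EFin \o f) ->
  mu.-integrable D (EFin \o (f \o mirror)).
Proof.
move=> /integrableP[/measurable_EFinP mf foo]; apply/integrableP; split.
  by apply/measurable_EFinP; exact: measurable_fun_mirror.
rewrite (ge0_integral_mirror (f := fun x => `|(f x)%:E|%E))//.
by do 2 apply: measurableT_comp => //.
Qed.

Lemma Rintegral_mirror (f : plane -> R) : measurable_fun D f ->
  \int[mu]_(x in D) f (mirror x) =
  \int[mu]_(x in D) f x.
Proof.
move=> mf; congr fine; apply: (integral_mirror (f := EFin \o f)).
exact/measurable_EFinP.
Qed.

End Reflection.

End PlaneMeasure.

(** * Real test functions and their symmetrization *)

Section PlaneCalculus.
Context {R : realType}.
Implicit Types (f g : R * R -> R) (U : set (R * R)) (x : R * R).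

(** A derivative along [v] depends only on the restriction of the function to a
    line; this transfers derivatives between the plane, its slices and its
    mirror image. *)
Lemma is_derive_line (V V' : normedModType R) (f : V -> R) (g : V' -> R)
    (x v : V) (y w : V') (d : R) :
  (forall h, f (h *: v + x) = g (h *: w + y)) ->
  is_derive y w g d -> is_derive x v f d.
Proof.
move=> fg [gy dg].
have fgE : (fun h => h^-1 *: ((f \o shift x) (h *: v) - f x)) =
           (fun h => h^-1 *: ((g \o shift y) (h *: w) - g y)).
  apply/funext => h /=; rewrite fg.
  by have := fg 0; rewrite !scale0r !add0r => ->.
by split; [rewrite /derivable fgE|rewrite /derive fgE].
Qed.

Lemma is_derive_horizontal f x (d : R) :
  is_derive x (e1 R) f d -> is_derive x.1 1 (fun s => f (s, x.2)) d.
Proof.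
apply: is_derive_line => h; congr f.
by rewrite /e1 -[RHS]/(h * 1 + x.1, h * 0 + x.2) mulr0 add0r.
Qed.

Lemma is_derive_vertical f x (d : R) :
  is_derive x (e2 R) f d <-> is_derive x.2 1 (fun s => f (x.1, s)) d.
Proof.
have E h : h *: e2 R + x = (x.1, h * 1 + x.2).
  by rewrite /e2 -[LHS]/(h * 0 + x.1, h * 1 + x.2) mulr0 add0r.
by split; apply: is_derive_line => h; rewrite E.
Qed.

Lemma is_derive_mirror1 f x (d : R) :
  is_derive (mirror x) (e1 R) f d -> is_derive x (e1 R) (f \o mirror) d.
Proof.
apply: is_derive_line => h; congr f.
rewrite /e1 /mirror -[RHS]/(h * 1 + x.1, h * 0 + - x.2) /=.
rewrite -[LHS]/(h * 1 + x.1, - (h * 0 + x.2)).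
by rewrite !mulr0 !add0r.
Qed.

Lemma is_derive_mirror2 f x (d : R) :
  is_derive (mirror x) (e2 R) f d -> is_derive x (e2 R) (f \o mirror) (- d).
Proof.
move=> /is_derive_vertical df; apply/is_derive_vertical.
have := @is_derive1_comp _ (fun s => f (x.1, s)) -%R x.2 d (-1).
by rewrite mulrN1; apply.
Qed.

(** Twice the even part of [f] for [b = 1], twice the odd part for [b = -1];
    with the coefficient as a parameter, the family is stable under both partial
    derivatives, the vertical one changing the sign of [b]. *)
Definition symmetrize (b : R) f : R * R -> R := fun x => f x + b * f (mirror x).

Lemma is_derive_symmetrize1 b f x :
  (forall y, derivable f y (e1 R)) ->
  is_derive x (e1 R) (symmetrize b f) (symmetrize b ('D_(e1 R) f) x).
Proof.
move=> df; apply: is_deriveD; first exact/derivableP.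
apply: (is_deriveZ (f := f \o mirror)).
by apply: is_derive_mirror1; exact/derivableP.
Qed.

Lemma is_derive_symmetrize2 b f x :
  (forall y, derivable f y (e2 R)) ->
  is_derive x (e2 R) (symmetrize b f) (symmetrize (- b) ('D_(e2 R) f) x).
Proof.
move=> df; rewrite [symmetrize (- b) _ x]/symmetrize mulNr -mulrN.
apply: is_deriveD; first exact/derivableP.
apply: (is_deriveZ (f := f \o mirror)).
by apply: is_derive_mirror2; exact/derivableP.
Qed.

Lemma continuous_symmetrize b f : continuous f -> continuous (symmetrize b f).
Proof.
move=> cf x; apply: cvgD; first exact: cf.
apply: cvgM; first exact: cvg_cst.
exact: (continuous_comp (@continuous_mirror R x) (cf _)).
Qed.

(** The induction needs all [b] at once, since the vertical derivative turns [b]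
    into [- b]. *)
Lemma continuously_differentiable_symmetrize n b f :
  continuously_differentiable n f -> continuously_differentiable n (symmetrize b f).
Proof.
elim: n b f => [|n ih] b f [cf Df]; split=> //; [| |move: Df => [df cd1 cd2]].
- exact: continuous_symmetrize.
- exact: continuous_symmetrize.
have d1 y : derivable f y (e1 R) by have [] := df y.
have d2 y : derivable f y (e2 R) by have [] := df y.
have -> : 'D_(e1 R) (symmetrize b f) = symmetrize b ('D_(e1 R) f).
  by apply/funext => x; have [] := is_derive_symmetrize1 b x d1.
have -> : 'D_(e2 R) (symmetrize b f) = symmetrize (- b) ('D_(e2 R) f).
  by apply/funext => x; have [] := is_derive_symmetrize2 b x d2.
split; [|exact: ih..] => x; split.
  by have [] := is_derive_symmetrize1 b x d1.
by have [] := is_derive_symmetrize2 b x d2.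
Qed.

Lemma continuously_differentiable0 n :
  continuously_differentiable n (fun=> 0 : R).
Proof.
elim: n => [|n ih]; first by split=> // x; exact: cvg_cst.
split; first by move=> x; exact: cvg_cst.
have D0 v : 'D_v (fun=> 0 : R) = (fun=> 0) :> (R * R -> R).
  by apply/funext => x; exact: derive_cst.
by rewrite !D0; split.
Qed.

(** Real-valued test functions; the support condition is phrased with a compact
    set off which the function vanishes, which sums and derivatives inherit. *)
Definition real_test U f := (forall n, continuously_differentiable n f) /\
  exists K : set (R * R), [/\ compact K, K `<=` U & forall x, ~ K x -> f x = 0].

Lemma plane_compact_closed (K : set (R * R)) : compact K -> closed K.
Proof. by apply: compact_closed; exact: norm_hausdorff. Qed.

Lemma derive_vanish f (K : set (R * R)) v x : closed K ->
  (forall y, ~ K y -> f y = 0) -> ~ K x -> 'D_v f x = 0.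
Proof.
move=> cK f0 Kx; rewrite -(derive_cst (0 : R) x v).
apply: near_eq_derive; have : nbhs x (~` K).
  by apply: open_nbhs_nbhs; split => //; exact: closed_openC.
by apply: filterS => y /f0.
Qed.

Lemma real_test_derivable U f x : real_test U f ->
  derivable f x (e1 R) /\ derivable f x (e2 R).
Proof. by case=> /(_ 1%N) [_ [/(_ x)]]. Qed.

Lemma real_test_derive1 U f : real_test U f -> real_test U ('D_(e1 R) f).
Proof.
move=> [cf [K [cK KU f0]]]; split; first by move=> n; have [_ []] := cf n.+1.
exists K; split=> // x.
by apply: derive_vanish => //; exact: plane_compact_closed.
Qed.

Lemma real_test_derive2 U f : real_test U f -> real_test U ('D_(e2 R) f).
Proof.
move=> [cf [K [cK KU f0]]]; split; first by move=> n; have [_ []] := cf n.+1.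
exists K; split=> // x.
by apply: derive_vanish => //; exact: plane_compact_closed.
Qed.

Lemma real_test_symmetrize U b f : (forall x, U x -> U (mirror x)) ->
  real_test U f -> real_test U (symmetrize b f).
Proof.
move=> sU [cf [K [cK KU f0]]]; split.
  by move=> n; exact: continuously_differentiable_symmetrize.
exists (K `|` mirror @` K); split.
- apply: compactU => //; apply: continuous_compact => //.
  exact/continuous_subspaceT/continuous_mirror.
- by move=> x [/KU//|[y /KU /sU Uy <-]].
- move=> x nKx; rewrite /symmetrize !f0 ?mulr0 ?addr0//.
    by move=> Kx; apply: nKx; right; exists (mirror x) => //; exact: mirrorK.
  by move=> Kx; apply: nKx; left.
Qed.

Lemma real_test_complex U f : real_test U f ->
  test_function U (fun x => real_complex R (f x)).
Proof.
move=> [cf [K [cK KU f0]]].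
have sK : closure [set x | real_complex R (f x) != 0] `<=` K.
  rewrite closureE; apply: smallest_sub; first exact: plane_compact_closed.
  move=> x /= fx; apply: contrapT => /f0 fx0.
  by move: fx; rewrite fx0 rmorph0 eqxx.
split=> //=.
- by move=> n; exact: continuously_differentiable0.
- by apply: (subclosed_compact _ cK) => //; exact: closed_closure.
- exact: subset_trans KU.
Qed.

(** Both components of a complex number are treated at once. *)
Definition part (b : bool) (z : R[i]) : R :=
  if b then complex.Re z else complex.Im z.

Lemma real_test_part U b (phi : R * R -> R[i]) : test_function U phi ->
  real_test U (part b \o phi).
Proof.
move=> [cr ci cK KU]; split; first by case: b.
exists (closure [set x | phi x != 0]); split => // x nx.
have -> : part b \o phi = (fun y => part b (phi y)) by [].
have /negPn/eqP phi0 : ~~ (phi x != 0).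
  by apply/negP => px; apply: nx; exact: subset_closure.
by rewrite phi0; case: b.
Qed.

Lemma part_cderive b v (u : R * R -> R[i]) x :
  part b (cderive v u x) = 'D_v (part b \o u) x.
Proof. by case: b. Qed.

Lemma cderive_real v f x :
  cderive v (fun y => real_complex R (f y)) x = real_complex R ('D_v f x).
Proof. by congr Complex; exact: derive_cst. Qed.

End PlaneCalculus.

(** * Integrals of derivatives over a square *)

Section SquareFubini.
Context {R : realType}.
Local Notation plane := (measurableTypeR R * measurableTypeR R)%type.
Local Notation mu := (@plane_measure R).
Local Notation itv M := ([set` `[- M, M]] : set R).
Implicit Types g : plane -> R.

Lemma square_sym (M : R) (x : R * R) : square M x <-> `|x.1| <= M /\ `|x.2| <= M.
Proof. by rewrite /square /= !in_itv/= !ler_norml. Qed.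

Lemma integral_horizontal0 g M : continuous (g : R * R -> R) ->
  (forall x, ~ square M x -> g x = 0) ->
  (forall y, \int[lebesgue_measure]_(x in itv M) (g (x, y))%:E = 0)%E ->
  (\int[mu]_x (g x)%:E = 0)%E.
Proof.
move=> cg g0 gy0.
rewrite -integral21_prod_meas1; last exact: integrable_continuous_square g0.
rewrite integral0_eq// => y _; rewrite /fubini_G -[RHS](gy0 y) [RHS]integral_mkcond.
apply: eq_integral => x _; rewrite patchE; case: ifPn => // xM.
rewrite /= g0// => -[/= Mx _].
by move: xM; rewrite notin_setE; apply.
Qed.

Lemma integral_vertical0 g M : continuous (g : R * R -> R) ->
  (forall x, ~ square M x -> g x = 0) ->
  (forall x, \int[lebesgue_measure]_(y in itv M) (g (x, y))%:E = 0)%E ->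
  (\int[mu]_x (g x)%:E = 0)%E.
Proof.
move=> cg g0 gx0.
rewrite -integral12_prod_meas1; last exact: integrable_continuous_square g0.
rewrite integral0_eq// => x _; rewrite /fubini_F -[RHS](gx0 x) [RHS]integral_mkcond.
apply: eq_integral => y _; rewrite patchE; case: ifPn => // yM.
rewrite /= g0// => -[/= _ My].
by move: yM; rewrite notin_setE; apply.
Qed.

Lemma integral_is_derive (F f : R -> R) (a b : R) : a < b ->
  {within `[a, b], continuous f} ->
  (forall x, a <= x <= b -> is_derive x 1 F (f x)) ->
  (\int[lebesgue_measure]_(x in `[a, b]) (f x)%:E = (F b - F a)%:E)%E.
Proof.
move=> ab cf dF; rewrite EFinB.
have cF x : a <= x <= b -> {for x, continuous F}.
  by move=> /dF[+ _]; move/derivable1_diffP/differentiable_continuous.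
apply: continuous_FTC2 => //.
- split.
  + by move=> x; rewrite in_itv/= => /andP[ax xb]; have [] := dF x; rewrite ?ltW.
  + by apply: cvg_at_right_filter; apply: cF; rewrite lexx ltW.
  + by apply: cvg_at_left_filter; apply: cF; rewrite lexx ltW.
- move=> x; rewrite in_itv/= => /andP[ax xb]; rewrite derive1E.
  by have [] := dF x; rewrite ?ltW.
Qed.

(** Since [f `|y|] is even, [- F (- y)] is a primitive of it on the negative
    half of the interval. *)
Lemma integral_even_is_derive (F f : R -> R) (M : R) : 0 < M ->
  continuous (fun y : R => f `|y|) ->
  (forall y, 0 <= y <= M -> is_derive y 1 F (f y)) ->
  (\int[lebesgue_measure]_(y in itv M) (f `|y|)%:E = ((F M - F 0) *+ 2)%:E)%E.
Proof.
move=> M0 cf dF.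
have mf D : measurable_fun D (fun y : R => (f `|y|)%:E).
  apply: measurable_funTS; apply/measurable_EFinP.
  exact: continuous_measurable_fun.
have -> : itv M = [set` `[- M, 0]] `|` [set` `]0, M]].
  by rewrite -itv_bndbnd_setU// bnd_simp ?oppr_le0 ltW.
rewrite integral_setU//=; last 2 first.
  exact: mf.
  rewrite disj_set2E; apply/eqP/seteqP; split=> // y /= [].
  by rewrite !in_itv/= => /andP[_ y0] /andP[]; rewrite ltNge y0.
rewrite integral_itv_obnd_cbnd//.
have dFN y : - M <= y <= 0 -> is_derive y 1 (fun y => - F (- y)) (f `|y|).
  move=> /andP[My y0].
  have dNF := @is_derive1_comp _ F -%R y (f (- y)) (-1).
  rewrite ler0_norm// -[f _]opprK -(mulrN1 (f (- y))).
  apply: is_deriveN; apply: dNF.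
  by apply: dF; rewrite oppr_ge0 y0 lerNl.
have dFP y : 0 <= y <= M -> is_derive y 1 F (f `|y|).
  by move=> /andP[y0 yM]; rewrite ger0_norm//; apply: dF; rewrite y0.
have NM0 : - M < 0 by rewrite oppr_lt0.
rewrite (integral_is_derive NM0 (continuous_subspaceT cf) dFN).
rewrite (integral_is_derive M0 (continuous_subspaceT cf) dFP).
by rewrite -EFinD oppr0 !opprK mulr2n; congr (_%:E); ring.
Qed.

End SquareFubini.

(** * The Poincare inequality for odd test functions *)

Section OddPoincare.
Context {R : realType}.
Local Notation itv M := ([set` `[- M, M]] : set R).
Variables (theta : R) (htheta : 0 < theta < pi / 2).
Let s := sin theta.
Let c := cos theta.
Local Notation Omega := (broken_guide theta).

Let s0 : 0 < s. Proof. exact: sin_gt0_pihalf. Qed.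
Let c0 : 0 < c.
Proof.
move: htheta => /andP[t0 t1]; apply: cos_gt0_pihalf; rewrite t1 andbT.
by rewrite (lt_trans _ t0)// oppr_lt0 divr_gt0// pi_gt0.
Qed.
Let sc1 : s ^+ 2 + c ^+ 2 = 1. Proof. by rewrite addrC; exact: cos2Dsin2. Qed.

(** The signed distance to the line that carries the lower edge of the upper
    half of the guide. *)
Definition depth (x : R * R) : R := c * x.2 - s * x.1.

(** The upper half of the guide has width [pi], so [depth] takes its values in
    the interval between 0 and [pi]. *)
Lemma sin_depth_gt0 x : Omega x -> 0 <= x.2 -> 0 < sin (depth x).
Proof.
rewrite /broken_guide/= /tan -/s -/c => /andP[lo hi] x2.
rewrite ger0_norm// in lo hi.
apply: sin_gt0_pi; apply/andP; split; rewrite /depth.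
  by move: lo; rewrite mulrA ltr_pdivrMr// subr_gt0 (mulrC c) (mulrC s).
move: hi; rewrite mulrA ltr_pdivlMr// mulrDl divfK ?gt_eqF//.
by rewrite ltrBlDr (mulrC c) (mulrC s) (addrC pi).
Qed.

Let cotd (x : R * R) : R := cos (depth x) / sin (depth x).
Let cscd2 (x : R * R) : R := (sin (depth x)) ^- 2.

Lemma is_derive_cot (t : R) : sin t != 0 ->
  is_derive t 1 (fun u => cos u / sin u) (- (sin t) ^- 2).
Proof.
move=> st.
have h := is_deriveV st (is_derive_sin t).
have := is_deriveM (is_derive_cos t) h.
move=> dM; apply: is_derive_eq dM _.
rewrite -![_ *: _]/(_ * _).
have := cos2Dsin2 t; move: (sin t) (cos t) st => S C S0 CS.
have CE : C ^+ 2 = 1 - S ^+ 2 by rewrite -CS addrK.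
transitivity (- (C ^+ 2) / S ^+ 2 - 1); first by field.
by rewrite CE; field.
Qed.

Lemma is_derive_cotd x v a : (forall h, depth (h *: v + x) = a * h + depth x) ->
  sin (depth x) != 0 -> is_derive x v cotd (- a * cscd2 x).
Proof.
move=> tv sx.
apply: (is_derive_line (g := fun h => cos (a * h + depth x) / sin (a * h + depth x))
  (y := 0) (w := 1)).
  by move=> h; rewrite /cotd tv addr0 -[h *: 1]/(h * 1) mulr1.
have -> : - a * cscd2 x = - cscd2 x * a by ring.
apply: (@is_derive1_comp _ (fun u => cos u / sin u) (fun h => a * h + depth x)).
  by rewrite mulr0 add0r; exact: is_derive_cot.
have h1 := is_deriveD (is_deriveZ a (is_derive_id (0 : R) 1))
  (is_derive_cst (depth x) (0 : R) 1).
by apply: is_derive_eq h1 _; rewrite addr0 -[_ *: _]/(_ * _) mulr1.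
Qed.


Lemma depth_e1 x h : depth (h *: e1 R + x) = - s * h + depth x.
Proof. by rewrite /depth /e1 -[_ *: _]/(h * 1, h * 0) /=; ring. Qed.

Lemma depth_e2 x h : depth (h *: e2 R + x) = c * h + depth x.
Proof. by rewrite /depth /e2 -[_ *: _]/(h * 0, h * 1) /=; ring. Qed.

Lemma continuous_depth : continuous (depth : R * R -> R).
Proof.
move=> x; apply: cvgB; apply: cvgM; try exact: cvg_cst.
  exact: cvg_snd.
exact: cvg_fst.
Qed.

Lemma continuous_cotd x : sin (depth x) != 0 -> {for x, continuous (cotd : R * R -> R)}.
Proof.
move=> sx; apply: cvgM.
  apply: (continuous_comp (@continuous_depth x)); exact: continuous_cos.
apply: cvgV => //; apply: (continuous_comp (@continuous_depth x)); exact: continuous_sin.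
Qed.

Lemma continuous_cscd2 x : sin (depth x) != 0 -> {for x, continuous (cscd2 : R * R -> R)}.
Proof.
move=> sx; apply: cvgV; first by rewrite expf_neq0.
apply: (@continuous_comp _ _ _ (sin \o depth) (fun y => y ^+ 2)).
  apply: (continuous_comp (@continuous_depth x)); exact: continuous_sin.
exact: exprn_continuous.
Qed.

(** The weight [w] may be singular outside [K], as [cot] is at the edges of the
    guide. *)
Lemma continuous_vanish_mul (K : set (R * R)) (u w : R * R -> R) x : closed K ->
  continuous u -> (forall y, ~ K y -> u y = 0) ->
  (K x -> {for x, continuous w}) -> {for x, continuous (fun y => u y * w y)}.
Proof.
move=> cK cu u0 cw; have [Kx|nKx] := pselect (K x).
  by apply: cvgM; [exact: cu|exact: cw].
rewrite /prop_for /continuous_at u0// mul0r.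
have u_eq0 : \forall y \near x, 0 = u y * w y.
  have : nbhs x (~` K).
    by apply: open_nbhs_nbhs; split => //; exact: closed_openC.
  by apply: filterS => y /u0 ->; rewrite mul0r.
exact: cvg_trans (near_eq_cvg u_eq0) (cvg_cst 0).
Qed.

(** Composing with this map turns functions that are regular on the closed
    upper half-plane into continuous functions on the plane. *)
Definition fold_up (x : R * R) : R * R := (x.1, `|x.2|).

Lemma continuous_fold_up : continuous (fold_up : R * R -> R * R).
Proof.
move=> x; apply: (@cvg_pair _ _ _ _ (nbhs x.1) (nbhs `|x.2|)).
  exact: cvg_fst.
apply: cvg_norm; exact: cvg_snd.
Qed.

Section OddTest.
Variables (chi : R * R -> R) (M : R) (K : set (R * R)).
Hypotheses (cchi : forall n, continuously_differentiable n chi).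
Hypotheses (cK : closed K) (KO : K `<=` Omega) (K0 : forall x, ~ K x -> chi x = 0).
Hypotheses (KM : forall x, K x -> `|x.1| < M /\ `|x.2| < M).
Hypotheses (M0 : 0 < M) (chi_odd : forall x, chi (mirror x) = - chi x).

Let chi1 : R * R -> R := 'D_(e1 R) chi.
Let chi2 : R * R -> R := 'D_(e2 R) chi.
(** The vector field is [flux] times the unit normal [(- s, c)] of the strip;
   [flux1] and [flux2] are the partial derivatives of [flux]. *)
Let flux x := chi x ^+ 2 * cotd x.
Let flux1 x := (chi x * chi1 x *+ 2) * cotd x + s * chi x ^+ 2 * cscd2 x.
Let flux2 x := (chi x * chi2 x *+ 2) * cotd x + (- c) * chi x ^+ 2 * cscd2 x.

Let sin_depth_neq0 x : K x -> 0 <= x.2 -> sin (depth x) != 0.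
Proof. by move=> /KO Kx x2; rewrite gt_eqF// sin_depth_gt0. Qed.

Let cont_chi : continuous chi. Proof. by have [] := cchi 0. Qed.
Let cont_chi1 : continuous chi1. Proof. by have [_ [_ []]] := cchi 1. Qed.
Let cont_chi2 : continuous chi2. Proof. by have [_ [_ _ []]] := cchi 1. Qed.

Let is_derive_flux v a (x : R * R) : (forall y h, depth (h *: v + y) = a * h + depth y) ->
  derivable chi x v -> 0 <= x.2 ->
  is_derive x v flux ((chi x * 'D_v chi x *+ 2) * cotd x + (- a) * chi x ^+ 2 * cscd2 x).
Proof.
move=> tv dchi x2; have [Kx|nKx] := pselect (K x).
  have h1 := is_derive_cotd (tv x) (sin_depth_neq0 Kx x2).
  have h2 := is_deriveX 2 (derivableP dchi).
  apply: is_derive_eq (is_deriveM h2 h1) _.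
  by rewrite -![_ *: _]/(_ * _) -[(chi ^+ 2) x]/(chi x ^+ 2) /=; ring.
have flux_eq0 : \forall y \near x, 0 = flux y.
  have : nbhs x (~` K).
    by apply: open_nbhs_nbhs; split => //; exact: closed_openC.
  by apply: filterS => y /K0; rewrite /flux => ->; rewrite expr2 !mul0r.
have d0 : is_derive x v (fun=> 0 : R) 0 := is_derive_cst 0 x v.
apply: is_derive_eq (near_eq_is_derive flux_eq0 d0) _.
by rewrite K0//; ring.
Qed.

Let is_derive_flux1 (x : R * R) : 0 <= x.2 -> is_derive x (e1 R) flux (flux1 x).
Proof.
move=> x2; have [_ [/(_ x)[d1 _] _ _]] := cchi 1.
have := is_derive_flux depth_e1 d1 x2; rewrite opprK; exact.
Qed.

Let is_derive_flux2 (x : R * R) : 0 <= x.2 -> is_derive x (e2 R) flux (flux2 x).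
Proof.
move=> x2; have [_ [/(_ x)[_ d2] _ _]] := cchi 1.
exact: is_derive_flux depth_e2 d2 x2.
Qed.

Let cont_flux (u : R * R -> R) a x : continuous u -> 0 <= x.2 ->
  {for x, continuous (fun x => (chi x * u x *+ 2) * cotd x + a * chi x ^+ 2 * cscd2 x)}.
Proof.
move=> cu x2; apply: cvgD.
  apply: (@continuous_vanish_mul K (fun x => chi x * u x *+ 2) cotd) => //.
  - by move=> y; apply: cvgMn; apply: cvgM; [exact: cont_chi|exact: cu].
  - by move=> y /K0 ->; rewrite mul0r mul0rn.
  - by move=> Kx; apply: continuous_cotd; exact: sin_depth_neq0.
apply: (@continuous_vanish_mul K (fun x => a * chi x ^+ 2) cscd2) => //.
- move=> y; apply: cvgM; first exact: cvg_cst.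
  by apply: (@continuous_comp _ _ _ chi (fun r => r ^+ 2));
    [exact: cont_chi|exact: exprn_continuous].
- by move=> y /K0 ->; rewrite expr2 !mulr0.
- by move=> Kx; apply: continuous_cscd2; exact: sin_depth_neq0.
Qed.

Let cont_flux1 x : 0 <= x.2 -> {for x, continuous flux1}.
Proof. by move=> x2; have := @cont_flux chi1 s x cont_chi1 x2. Qed.

Let cont_flux2 x : 0 <= x.2 -> {for x, continuous flux2}.
Proof. by move=> x2; have := @cont_flux chi2 (- c) x cont_chi2 x2. Qed.

Let nK_square x : ~ square M x -> ~ K x.
Proof. by move=> nM /KM[x1 x2]; apply/nM/square_sym; split; exact: ltW. Qed.

Let fold_square x : ~ square M x -> ~ square M (fold_up x).
Proof. by move=> nM /square_sym/=; rewrite normr_id => /square_sym. Qed.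

Let cont_fold_up (u : R * R -> R) : (forall x, 0 <= x.2 -> {for x, continuous u}) ->
  continuous (u \o fold_up).
Proof.
move=> cu x; apply: (continuous_comp (@continuous_fold_up x)).
by apply: cu => /=.
Qed.

Let flux0 x : ~ K x -> flux x = 0.
Proof. by move=> /K0; rewrite /flux => ->; rewrite expr2 !mul0r. Qed.

Let fluxi0 (u : R * R -> R) a x : ~ K x ->
  (chi x * u x *+ 2) * cotd x + a * chi x ^+ 2 * cscd2 x = 0.
Proof. by move=> /K0 ->; ring. Qed.

Let on_axis0 (r : R) : chi (r, 0) = 0.
Proof.
have := chi_odd (r, 0); rewrite /mirror/= oppr0 => /eqP.
by rewrite -subr_eq0 opprK -mulr2n mulrn_eq0 => /eqP.
Qed.

(** Each horizontal slice contributes the increment of [flux], which vanishes at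
   both ends. *)
Let integral_flux1 : (\int[@plane_measure R]_x (flux1 (fold_up x))%:E = 0)%E.
Proof.
apply: (@integral_horizontal0 _ (flux1 \o fold_up) M).
- by apply: cont_fold_up => x; exact: cont_flux1.
- by move=> x /fold_square /nK_square; exact: fluxi0.
move=> y; rewrite /fold_up/=.
have cf : {within itv M, continuous (fun r => flux1 (r, `|y|))}.
  apply: continuous_subspaceT => r.
  apply: (@continuous_comp _ _ _ (fun r => (r, `|y|)) flux1).
    apply: (@cvg_pair _ _ _ _ (nbhs r) (nbhs `|y|)); first exact: cvg_id.
    exact: cvg_cst.
  by apply: cont_flux1 => /=.
have dF r : - M <= r <= M -> is_derive r 1 (fun r => flux (r, `|y|)) (flux1 (r, `|y|)).
  move=> _; have /is_derive_horizontal := @is_derive_flux1 (r, `|y|) (normr_ge0 y).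
  exact.
have MM : - M < M by rewrite gtrN.
rewrite (integral_is_derive MM cf dF).
have nKM r : `|r| = M -> ~ K (r, `|y|).
  by move=> rM /KM[/=]; rewrite rM ltxx.
by rewrite !flux0 ?subrr//; apply: nKM; rewrite ?normrN gtr0_norm.
Qed.

(** On a vertical slice the primitive runs from the axis to the top of the
   square; it vanishes on the axis because an odd function does. *)
Let integral_flux2 : (\int[@plane_measure R]_x (flux2 (fold_up x))%:E = 0)%E.
Proof.
apply: (@integral_vertical0 _ (flux2 \o fold_up) M).
- by apply: cont_fold_up => x; exact: cont_flux2.
- by move=> x /fold_square /nK_square; exact: fluxi0.
move=> r; rewrite /fold_up/=.
have cf : continuous (fun y : R => flux2 (r, `|y|)).
  move=> y; apply: (@continuous_comp _ _ _ (fun y : R => (r, `|y|)) flux2).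
    apply: (@cvg_pair _ _ _ _ (nbhs r) (nbhs `|y|)); first exact: cvg_cst.
    by apply: cvg_norm; exact: cvg_id.
  by apply: cont_flux2 => /=.
have dF y : 0 <= y <= M -> is_derive y 1 (fun y => flux (r, y)) (flux2 (r, y)).
  by move=> /andP[y0 _]; have /is_derive_vertical := @is_derive_flux2 (r, y) y0.
rewrite (integral_even_is_derive M0 cf dF).
rewrite flux0; last by move=> /KM[_ /=]; rewrite gtr0_norm// ltxx.
by rewrite /flux on_axis0 expr2 !mul0r subrr mul0rn.
Qed.

Let chi1_0 x : ~ K x -> chi1 x = 0.
Proof. exact: derive_vanish. Qed.

Let chi2_0 x : ~ K x -> chi2 x = 0.
Proof. exact: derive_vanish. Qed.

Let chi1_odd x : chi1 (mirror x) = - chi1 x.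
Proof.
have dchi y : derivable chi y (e1 R) by have [_ [/(_ y)[]]] := cchi 1.
have [_ D] := is_derive_mirror1 (derivableP (dchi (mirror x))).
rewrite /chi1 -D.
have -> : chi \o mirror = - chi by apply/funext => y; exact: chi_odd.
exact: deriveN.
Qed.

Let chi2_even x : chi2 (mirror x) = chi2 x.
Proof.
have dchi y : derivable chi y (e2 R) by have [_ [/(_ y)[]]] := cchi 1.
have [_ D] := is_derive_mirror2 (derivableP (dchi (mirror x))).
apply: oppr_inj; rewrite /chi2 -D.
have -> : chi \o mirror = - chi by apply/funext => y; exact: chi_odd.
exact: deriveN.
Qed.

Let energy x := chi1 x ^+ 2 + chi2 x ^+ 2 - chi x ^+ 2.

Let energy_fold_up x : energy (fold_up x) = energy x.
Proof.
rewrite /energy; have [x2|x2] := leP 0 x.2.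
  by rewrite /fold_up ger0_norm//; case: x x2.
have -> : fold_up x = mirror x by rewrite /fold_up /mirror ltr0_norm.
by rewrite chi_odd chi1_odd chi2_even !sqrrN.
Qed.

(** With [w = cot t] and [1 / sin^2 t = 1 + w^2], the difference of the two sides
   is [(tangential derivative)^2 + (normal derivative - chi w)^2]. *)
Let divergence_le_energy x :
  - s * flux1 (fold_up x) + c * flux2 (fold_up x) <= energy x.
Proof.
rewrite -energy_fold_up; have x2 : 0 <= (fold_up x).2 by rewrite /fold_up/=.
move: (fold_up x) x2 => {}x x2; rewrite /energy /flux1 /flux2.
have [Kx|nKx] := pselect (K x); last first.
  by rewrite K0// chi1_0// chi2_0//; lra.
have cscE : cscd2 x = 1 + cotd x ^+ 2.
  rewrite /cscd2 /cotd; have := cos2Dsin2 (depth x).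
  move: (sin_depth_neq0 Kx x2); move: (sin _) (cos _) => S C S0 CS.
  by rewrite expr_div_n -[1](@mulfV _ (S ^+ 2)) ?expf_neq0// -mulrDl addrC CS mul1r.
rewrite cscE; move: (chi x) (chi1 x) (chi2 x) (cotd x) => u a b w.
have -> : a ^+ 2 + b ^+ 2 = (c * a + s * b) ^+ 2 + (- s * a + c * b) ^+ 2.
  rewrite -[a ^+ 2]mul1r -[b ^+ 2]mul1r -sc1; ring.
rewrite -subr_ge0; have : 0 <= (c * a + s * b) ^+ 2 + (- s * a + c * b - u * w) ^+ 2.
  by rewrite addr_ge0// sqr_ge0.
congr (0 <= _).
have -> : - s * (u * a *+ 2 * w + s * u ^+ 2 * (1 + w ^+ 2)) +
 c * (u * b *+ 2 * w + - c * u ^+ 2 * (1 + w ^+ 2)) =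
  (- s * a + c * b) * u * w *+ 2 - (s ^+ 2 + c ^+ 2) * (u ^+ 2 * (1 + w ^+ 2)) by ring.
by rewrite sc1; ring.
Qed.

Let integrable_cc (g : R * R -> R) (D : set (R * R)) : measurable D ->
  continuous g -> (forall x, ~ K x -> g x = 0) ->
  (@plane_measure R).-integrable D (EFin \o g).
Proof.
move=> mD cg g0; apply: (@integrable_continuous_square _ _ M) => // x nM.
by apply: g0; exact: nK_square.
Qed.

Let cont_sqr (g : R * R -> R) : continuous g -> continuous (fun x => g x ^+ 2).
Proof.
by move=> cg x; apply: (@continuous_comp _ _ _ g (fun r => r ^+ 2));
  [exact: cg|exact: exprn_continuous].
Qed.

Let sqr0 (g : R * R -> R) x : g x = 0 -> g x ^+ 2 = 0.
Proof. by move=> ->; rewrite expr2 mul0r. Qed.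

Lemma odd_poincare_square : measurable Omega ->
  \int[@plane_measure R]_(x in Omega) (chi x ^+ 2) <=
  \int[@plane_measure R]_(x in Omega) (chi1 x ^+ 2 + chi2 x ^+ 2).
Proof.
move=> mO.
have int_chi D : measurable D ->
    (@plane_measure R).-integrable D (EFin \o (fun x => chi x ^+ 2)).
  move=> mD; apply: integrable_cc => //; first exact: cont_sqr.
  by move=> x nK; apply: sqr0; exact: K0.
have int_grad D : measurable D -> (@plane_measure R).-integrable D
    (EFin \o (fun x => chi1 x ^+ 2 + chi2 x ^+ 2)).
  move=> mD; apply: integrable_cc => //.
    by move=> x; apply: cvgD; exact: cont_sqr.
  by move=> x nK; rewrite (sqr0 (chi1_0 nK)) (sqr0 (chi2_0 nK)) addr0.
rewrite -subr_ge0 -RintegralB//; [|exact: int_grad|exact: int_chi].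
rewrite Rintegral_mkcond.
have -> : (fun x => chi1 x ^+ 2 + chi2 x ^+ 2 - chi x ^+ 2) \_ Omega = energy.
  apply/funext => x; rewrite patchE; case: ifPn => // /negP nO.
  have nK : ~ K x by move=> /KO Ox; apply: nO; rewrite inE.
  by rewrite /energy (sqr0 (chi1_0 nK)) (sqr0 (chi2_0 nK)) (sqr0 (K0 nK)) addr0 subr0.
have int1 : (@plane_measure R).-integrable setT (EFin \o (flux1 \o fold_up)).
  apply: (@integrable_continuous_square _ _ M) => //.
    by apply: cont_fold_up => x; exact: cont_flux1.
  by move=> x /fold_square /nK_square; exact: fluxi0.
have int2 : (@plane_measure R).-integrable setT (EFin \o (flux2 \o fold_up)).
  apply: (@integrable_continuous_square _ _ M) => //.
    by apply: cont_fold_up => x; exact: cont_flux2.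
  by move=> x /fold_square /nK_square; exact: fluxi0.
have <- : \int[@plane_measure R]_(x in setT)
    (- s * (flux1 \o fold_up) x + c * (flux2 \o fold_up) x) = 0.
  rewrite RintegralD//; [|exact: integrable_mulR..].
  rewrite !RintegralZl//.
  by rewrite /Rintegral integral_flux1 integral_flux2 !mulr0 addr0.
apply: le_Rintegral => //.
  by apply: integrable_addR => //; exact: integrable_mulR.
  by apply: integrable_subR => //; [exact: int_grad|exact: int_chi].
by move=> x _; exact: divergence_le_energy.
Qed.

End OddTest.

Lemma odd_poincare (chi : R * R -> R) : measurable Omega -> real_test Omega chi ->
  (forall x, chi (mirror x) = - chi x) ->
  \int[@plane_measure R]_(x in Omega) (chi x ^+ 2) <=
  \int[@plane_measure R]_(x in Omega)
     ('D_(e1 R) chi x ^+ 2 + 'D_(e2 R) chi x ^+ 2).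
Proof.
move=> mO [cchi [K [cK KO K0]]] chi_odd.
have [M0 [_ M0K]] := compact_bounded cK.
pose M := `|M0| + 2.
apply: (@odd_poincare_square chi M K) => //.
- exact: plane_compact_closed.
- move=> x /(M0K (`|M0| + 1)) Kx.
  have : `|x| <= `|M0| + 1 by apply: Kx; rewrite (le_lt_trans (ler_norm _))// ltrDl.
  rewrite prod_normE ge_max => /andP[x1 x2].
  by split; [apply: le_lt_trans x1 _|apply: le_lt_trans x2 _]; rewrite /M ltrD2l ltr1n.
- by rewrite /M ltr_wpDl.
Qed.

End OddPoincare.

(** * Vanishing of the odd part of a real eigenfunction *)

Lemma young (R : realFieldType) (d u v : R) : 0 < d ->
  u * v <= (4 * d)^-1 * u ^+ 2 + d * v ^+ 2.
Proof.
move=> d0; rewrite -subr_ge0.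
have -> : (4 * d)^-1 * u ^+ 2 + d * v ^+ 2 - u * v = d * (v - u / (2 * d)) ^+ 2.
  by field; rewrite gt_eqF.
by rewrite mulr_ge0 ?sqr_ge0// ltW.
Qed.

(** Coercivity of the form for [lambda < 1]: half of the gap [1 - lambda] pays
    for the error terms [d (G + X)]; a negative [lambda] is covered because the
    coefficient of [G] stays nonnegative. *)
Lemma absorb (R : realFieldType) (lambda d X G S T : R) :
  2 * d <= 1 -> 4 * d <= (1 - lambda) / 2 -> 0 <= X -> X <= G ->
  G - lambda * X <= (S + d * (G + X)) *+ 2 -> S <= T ->
  (1 - lambda) / 2 * X <= T *+ 2.
Proof.
move=> d2 d4 X0 XG le1 ST.
have le3 : (1 - 2 * d) * X <= (1 - 2 * d) * G by rewrite ler_wpM2l ?subr_ge0.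
have le4 : 4 * d * X <= (1 - lambda) / 2 * X by rewrite ler_wpM2r.
by move: le1; rewrite mulr2n [T *+ 2]mulr2n; lra.
Qed.

Lemma weighted_sum_le (R : realFieldType) (lambda A A1 A2 eps : R) :
  0 <= A -> 0 <= A1 -> 0 <= A2 -> A + A1 + A2 <= eps ->
  A1 + A2 + lambda ^+ 2 * A <= (1 + lambda ^+ 2) * eps.
Proof.
move=> A0 A10 A20 le_eps; have := sqr_ge0 lambda; move: (lambda ^+ 2) => l l0.
rewrite mulrDl mul1r; apply: lerD; first by move: le_eps; lra.
by rewrite ler_wpM2l//; move: le_eps; lra.
Qed.

Section Evenness.
Context {R : realType}.
Local Notation plane := (measurableTypeR R * measurableTypeR R)%type.
Local Notation mu := (@plane_measure R).
Variable U : set plane.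
Hypotheses (mU : measurable U) (sU : forall x, U x -> U (mirror x)).
Local Notation I f := (Rintegral mu U f).
Local Notation intU f := (mu.-integrable U (EFin \o f)).

Definition real_L2 (f : plane -> R) :=
  measurable_fun U f /\ intU (fun x => f x ^+ 2).

Lemma integrable_real_L2M f g : real_L2 f -> real_L2 g -> intU (fun x => f x * g x).
Proof.
move=> [mf f2] [mg g2].
apply: (@le_integrable _ _ _ _ U mU _ (EFin \o (fun x => f x ^+ 2 + g x ^+ 2))).
- by apply/measurable_EFinP; exact: measurable_funM.
- move=> x _; rewrite /= lee_fin normrM [leRHS]ger0_norm ?addr_ge0 ?sqr_ge0//.
  have := sqr_ge0 (`|f x| - `|g x|); have := sqr_ge0 (`|f x| + `|g x|).
  by rewrite -(real_normK (num_real (f x))) -(real_normK (num_real (g x))); nra.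
- exact: integrable_addR.
Qed.

Lemma real_L2_sum f g a b : real_L2 f -> real_L2 g ->
  real_L2 (fun x => a * f x + b * g x).
Proof.
move=> Lf Lg; have [[mf f2] [mg g2]] := (Lf, Lg); split.
  by apply: measurable_funD; apply: measurable_funM => //; exact: measurable_cst.
have -> : (fun x => (a * f x + b * g x) ^+ 2) = (fun x => (a ^+ 2 * f x ^+ 2 +
    (a * b *+ 2) * (f x * g x)) + b ^+ 2 * g x ^+ 2).
  by apply/funext => x; ring.
apply: integrable_addR => //; last exact: integrable_mulR.
apply: integrable_addR => //; first exact: integrable_mulR.
by apply: integrable_mulR => //; exact: integrable_real_L2M.
Qed.

Lemma real_L2_sub f g : real_L2 f -> real_L2 g -> real_L2 (fun x => f x - g x).
Proof.
move=> Lf Lg; have := real_L2_sum 1 (-1) Lf Lg.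
by under eq_fun do rewrite mul1r mulN1r.
Qed.

Lemma real_L2_mirror f : real_L2 f -> real_L2 (f \o mirror).
Proof.
move=> [mf f2]; split; first exact: measurable_fun_mirror.
exact: (integrable_mirror mU sU f2).
Qed.

Lemma real_L2_test f : real_test U f -> real_L2 f.
Proof.
move=> [/(_ 0%N)[cf _] [K [cK _ f0]]].
split; first by apply: measurable_funTS; exact: continuous_measurable_plane.
have [M0 [_ M0K]] := compact_bounded cK.
apply: (@integrable_continuous_square _ _ (`|M0| + 1)) => //.
  by move=> x; apply: (@continuous_comp _ _ _ f (fun r => r ^+ 2));
    [exact: cf|exact: exprn_continuous].
move=> x nM; rewrite f0 ?expr0n// => Kx; apply: nM; apply/square_sym.
have := M0K (`|M0| + 1); rewrite (le_lt_trans (ler_norm _)) ?ltrDl// => /(_ isT x Kx).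
by rewrite /= prod_normE ge_max => /andP[].
Qed.

Section RealEigenfunction.
Variables (lambda : R) (p h1 h2 : plane -> R).
Hypotheses (lambda1 : lambda < 1).
Hypothesis poincare : forall chi, real_test U chi ->
  (forall x, chi (mirror x) = - chi x) ->
  I (fun x => chi x ^+ 2) <= I (fun x => 'D_(e1 R) chi x ^+ 2 + 'D_(e2 R) chi x ^+ 2).
Hypotheses (Lp : real_L2 p) (Lh1 : real_L2 h1) (Lh2 : real_L2 h2).
Hypothesis weak : forall chi, real_test U chi ->
  I (fun x => h1 x * 'D_(e1 R) chi x + h2 x * 'D_(e2 R) chi x)
  = lambda * I (fun x => p x * chi x).
Hypothesis approx : forall eps, 0 < eps -> exists2 phi, real_test U phi &
  I (fun x => (phi x - p x) ^+ 2) + I (fun x => ('D_(e1 R) phi x - h1 x) ^+ 2)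
  + I (fun x => ('D_(e2 R) phi x - h2 x) ^+ 2) <= eps.

(** The weight in Young's inequality: small enough for both bounds of [d_le]
   whatever the size of the gap [1 - lambda]. *)
Let d := (1 - lambda) / (8 + 2 * (1 - lambda)).
Let d_gt0 : 0 < d.
Proof. by apply: divr_gt0; move: lambda1; lra. Qed.
Let d_le : 2 * d <= 1 /\ 4 * d <= (1 - lambda) / 2.
Proof.
rewrite /d; have m0 : 0 < 1 - lambda by rewrite subr_gt0.
move: (1 - lambda) m0 => m m0; split.
  by rewrite mulrA ler_pdivrMr; lra.
by rewrite mulrA ler_pdivrMr; nra.
Qed.

Let C1 := 2 / (1 - lambda) * (2 * (4 * d)^-1 * (1 + lambda ^+ 2)).

(** [F] and [W] are the integrands of [E(phi, chi)] and [E(psi, chi)], and [a],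
   [a1], [a2] are the components of [phi - psi] and of its gradient, so that
   [F - W] is the integrand of [E(phi - psi, chi)]. *)
Let odd_part_bound eps (phi : R * R -> R) : real_test U phi ->
  I (fun x => (phi x - p x) ^+ 2) + I (fun x => ('D_(e1 R) phi x - h1 x) ^+ 2)
  + I (fun x => ('D_(e2 R) phi x - h2 x) ^+ 2) <= eps ->
  I (fun x => symmetrize (-1) phi x ^+ 2) <= C1 * eps.
Proof.
move=> tphi le_eps.
have dphi x : derivable phi x (e1 R) /\ derivable phi x (e2 R).
  exact: real_test_derivable tphi.
pose chi := symmetrize (-1) phi.
pose phi1 : R * R -> R := 'D_(e1 R) phi; pose phi2 : R * R -> R := 'D_(e2 R) phi.
pose chi1 := symmetrize (-1) phi1; pose chi2 := symmetrize 1 phi2.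
have tchi : real_test U chi by exact: real_test_symmetrize.
have D1 x : 'D_(e1 R) chi x = chi1 x.
  by have [] := is_derive_symmetrize1 (-1) x (fun y => (dphi y).1).
have D2 x : 'D_(e2 R) chi x = chi2 x.
  have [_ ->] := is_derive_symmetrize2 (-1) x (fun y => (dphi y).2).
  by rewrite opprK.
have Lphi := real_L2_test tphi.
have Lphi1 : real_L2 phi1 := real_L2_test (real_test_derive1 tphi).
have Lphi2 : real_L2 phi2 := real_L2_test (real_test_derive2 tphi).
have Lchi := real_L2_test tchi.
have Lchi1 : real_L2 chi1.
  have -> : chi1 = 'D_(e1 R) chi by exact/funext.
  exact: real_L2_test (real_test_derive1 tchi).
have Lchi2 : real_L2 chi2.
  have -> : chi2 = 'D_(e2 R) chi by exact/funext.
  exact: real_L2_test (real_test_derive2 tchi).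
have La := real_L2_sub Lphi Lp.
have La1 := real_L2_sub Lphi1 Lh1.
have La2 := real_L2_sub Lphi2 Lh2.
have chi_odd x : chi (mirror x) = - chi x by rewrite /chi /symmetrize mirrorK; ring.
have chi1_odd x : chi1 (mirror x) = - chi1 x by rewrite /chi1 /symmetrize mirrorK; ring.
have chi2_even x : chi2 (mirror x) = chi2 x by rewrite /chi2 /symmetrize mirrorK; ring.
pose X := I (fun x => chi x ^+ 2); pose G := I (fun x => chi1 x ^+ 2 + chi2 x ^+ 2).
have XG : X <= G.
  apply: le_trans (poincare tchi chi_odd) _.
  by rewrite le_eqVlt; apply/orP; left; apply/eqP/eq_Rintegral => x _; rewrite D1 D2.
pose F x := (phi1 x * chi1 x + phi2 x * chi2 x) + (- lambda) * (phi x * chi x).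
pose W x := (h1 x * chi1 x + h2 x * chi2 x) + (- lambda) * (p x * chi x).
have intF : intU F.
  apply: integrable_addR => //; last first.
    by apply: integrable_mulR => //; exact: integrable_real_L2M.
  by apply: integrable_addR => //; exact: integrable_real_L2M.
have intW : intU W.
  apply: integrable_addR => //; last first.
    by apply: integrable_mulR => //; exact: integrable_real_L2M.
  by apply: integrable_addR => //; exact: integrable_real_L2M.
have IW : I W = 0.
  rewrite RintegralD//; last 2 first.
  - by apply: integrable_addR => //; exact: integrable_real_L2M.
  - by apply: integrable_mulR => //; exact: integrable_real_L2M.
  rewrite RintegralZl//; last exact: integrable_real_L2M.
  rewrite mulNr -(weak tchi); apply/eqP; rewrite subr_eq0; apply/eqP.
  by apply: eq_Rintegral => x _; rewrite D1 D2.
have intG : intU (fun x => chi1 x ^+ 2 + chi2 x ^+ 2).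
  by apply: integrable_addR => //; [case: Lchi1|case: Lchi2].
have intX : intU (fun x => chi x ^+ 2) by case: Lchi.
have IF : I F *+ 2 = G - lambda * X.
  have -> : I F *+ 2 = I F + I (F \o mirror).
    by rewrite mulr2n Rintegral_mirror//; case/integrableP : intF => /measurable_EFinP.
  rewrite -RintegralD//; last exact: (integrable_mirror mU sU intF).
  rewrite -RintegralZl// -RintegralB//; last exact: integrable_mulR.
  apply: eq_Rintegral => x _.
  rewrite /F /= chi_odd chi1_odd chi2_even.
  by rewrite /chi /chi1 /chi2 /symmetrize; ring.
pose a x := phi x - p x.
pose a1 x := phi1 x - h1 x.
pose a2 x := phi2 x - h2 x.
pose k := (4 * d)^-1.
have k0 : 0 < k by rewrite invr_gt0 mulr_gt0.
pose B x := k * ((a1 x ^+ 2 + a2 x ^+ 2) + lambda ^+ 2 * a x ^+ 2)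
  + d * ((chi1 x ^+ 2 + chi2 x ^+ 2) + chi x ^+ 2).
have inta : intU (fun x => a x ^+ 2) by case: La.
have inta1 : intU (fun x => a1 x ^+ 2) by case: La1.
have inta2 : intU (fun x => a2 x ^+ 2) by case: La2.
have intla : intU (fun x => lambda ^+ 2 * a x ^+ 2) by exact: integrable_mulR.
have inta12 : intU (fun x => a1 x ^+ 2 + a2 x ^+ 2) by exact: integrable_addR.
have intA : intU (fun x => (a1 x ^+ 2 + a2 x ^+ 2) + lambda ^+ 2 * a x ^+ 2).
  exact: integrable_addR.
have intGX : intU (fun x => (chi1 x ^+ 2 + chi2 x ^+ 2) + chi x ^+ 2).
  exact: integrable_addR.
have intkA : intU (fun x => k * ((a1 x ^+ 2 + a2 x ^+ 2) + lambda ^+ 2 * a x ^+ 2)).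
  exact: integrable_mulR.
have intdGX : intU (fun x => d * ((chi1 x ^+ 2 + chi2 x ^+ 2) + chi x ^+ 2)).
  exact: integrable_mulR.
have intB : intU B by exact: integrable_addR.
have IB : I B = k * (I (fun x => a1 x ^+ 2) + I (fun x => a2 x ^+ 2)
    + lambda ^+ 2 * I (fun x => a x ^+ 2)) + d * (G + X).
  rewrite /B (RintegralD mU intkA intdGX) (RintegralZl _ mU intA).
  rewrite (RintegralZl _ mU intGX) (RintegralD mU inta12 intla).
  rewrite (RintegralD mU inta1 inta2) (RintegralZl _ mU inta).
  by rewrite (RintegralD mU intG intX).
have FB : I F <= I B.
  rewrite -[I F]subr0 -IW -RintegralB//.
  apply: le_Rintegral => //; first exact: integrable_subR.
  move=> x _; have := young (a1 x) (chi1 x) d_gt0; have := young (a2 x) (chi2 x) d_gt0.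
  have := young (- lambda * a x) (chi x) d_gt0; rewrite -/k.
  have -> : F x - W x = a1 x * chi1 x + a2 x * chi2 x + - lambda * a x * chi x.
    by rewrite /F /W /a /a1 /a2; ring.
  rewrite /B exprMn sqrrN; lra.
have A_ge0 (f : plane -> R) : 0 <= I (fun x => f x ^+ 2).
  by apply: Rintegral_ge0 => x _; exact: sqr_ge0.
have A0 := A_ge0 a; have A10 := A_ge0 a1; have A20 := A_ge0 a2; have X0 := A_ge0 chi.
have {}le_eps : I (fun x => a x ^+ 2) + I (fun x => a1 x ^+ 2)
  + I (fun x => a2 x ^+ 2) <= eps := le_eps.
have {}X0 : 0 <= X := X0; suff : X <= C1 * eps by [].
move: A0 A10 A20 le_eps IB.
set A := I _; set A1 := I _; set A2 := I _ => A0 A10 A20 le_eps IB.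
have key : (1 - lambda) / 2 * X <= (k * ((1 + lambda ^+ 2) * eps)) *+ 2.
  have [d2 d4] := d_le.
  apply: (@absorb _ _ d X G (k * (A1 + A2 + lambda ^+ 2 * A))) => //.
    by rewrite -IF -IB ler_pMn2r.
  by rewrite ler_pM2l// weighted_sum_le.
have m0 : 0 < 1 - lambda by rewrite subr_gt0.
have -> : C1 * eps = 2 / (1 - lambda) * (k * ((1 + lambda ^+ 2) * eps) *+ 2).
  by rewrite /C1 /k; move: (4 * d)^-1 (1 - lambda)^-1 => r t; ring.
by rewrite -ler_pdivrMl ?divr_gt0// invf_div.
Qed.

(** The bound on the odd part of an approximation [phi] carries over to [p] in
    L^2, the mirror image of [phi - p] having the same norm as [phi - p]. *)
Lemma odd_part_eq0 : I (fun x => (p x - p (mirror x)) ^+ 2) = 0.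
Proof.
have Lq := real_L2_sub Lp (real_L2_mirror Lp).
have le_C eps : 0 < eps -> I (fun x => (p x - p (mirror x)) ^+ 2) <= 3 * (C1 + 2) * eps.
  move=> eps0; have [phi tphi le_eps] := approx eps0.
  have X_le := odd_part_bound tphi le_eps.
  have Lphi := real_L2_test tphi.
  have [_ inta] := real_L2_sub Lphi Lp.
  have [_ intX] := real_L2_test (real_test_symmetrize (-1) sU tphi).
  have intam := integrable_mirror mU sU inta.
  pose X x := symmetrize (-1) phi x ^+ 2.
  pose A x := (phi x - p x) ^+ 2.
  have A_le : I A <= eps.
    apply: le_trans le_eps; rewrite -addrA lerDl addr_ge0//.
      by apply: Rintegral_ge0 => x _; exact: sqr_ge0.
    by apply: Rintegral_ge0 => x _; exact: sqr_ge0.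
  have IAm : I (A \o mirror) = I A.
    by rewrite Rintegral_mirror//; case/integrableP : inta => /measurable_EFinP.
  have int1 : intU (fun x => X x + A x) by exact: integrable_addR.
  have int2 : intU (fun x => X x + A x + (A \o mirror) x) by exact: integrable_addR.
  apply: (@le_trans _ _ (I (fun x => 3 * (X x + A x + (A \o mirror) x)))).
    apply: le_Rintegral => //; [by case: Lq|exact: integrable_mulR|].
    move=> x _; rewrite /X /A /symmetrize /=.
    move: (phi x) (phi (mirror x)) (p x) (p (mirror x)) => u v y z.
    have := sqr_ge0 (u - v + (u - y)); have := sqr_ge0 (u - v - (v - z)).
    have := sqr_ge0 (u - y + (v - z)); nra.
  rewrite RintegralZl// RintegralD// RintegralD// IAm.
  have {}X_le : I X <= C1 * eps := X_le.
  have -> : I [eta X] = I X by [].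
  by have -> : I [eta A] = I A by []; lra.
apply/eqP; rewrite eq_le Rintegral_ge0 ?andbT; last by move=> x _; exact: sqr_ge0.
apply/ler_addgt0Pr => e e0; rewrite add0r.
have C0 : 0 < 3 * (C1 + 2).
  have m0 : 0 < 1 - lambda by rewrite subr_gt0.
  have d_ge0 := ltW d_gt0.
  rewrite mulr_gt0// ltr_wpDl// /C1 mulr_ge0//; first by rewrite divr_ge0// ltW.
  by rewrite mulr_ge0 ?addr_ge0 ?sqr_ge0// divr_ge0// mulr_ge0.
have -> : e = 3 * (C1 + 2) * (e / (3 * (C1 + 2))) by rewrite mulrC divfK ?gt_eqF.
by apply: le_C; rewrite divr_gt0.
Qed.

End RealEigenfunction.

End Evenness.

(** * Real and imaginary parts of the eigenfunction *)

Section ComplexParts.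
Context {R : realType}.
Local Notation plane := (measurableTypeR R * measurableTypeR R)%type.
Local Notation mu := (@plane_measure R).
Variable U : set plane.
Hypotheses (mU : measurable U).
Local Notation I f := (Rintegral mu U f).
Local Notation intU f := (mu.-integrable U (EFin \o f)).

Lemma part_sqr_le b (z : R[i]) : part b z ^+ 2 <= complex.Re z ^+ 2 + complex.Im z ^+ 2.
Proof. by case: b; rewrite /part ?lerDl ?lerDr sqr_ge0. Qed.

Lemma part_mul_real b (z : R[i]) r : part b (z * real_complex R r) = part b z * r.
Proof. by case: z => x y; case: b; rewrite /part/= mulr0 ?subr0 ?add0r. Qed.

Lemma partN b (z : R[i]) : part b (- z) = - part b z.
Proof. by case: z => x y; case: b. Qed.

Lemma partB b (z w : R[i]) : part b (z - w) = part b z - part b w.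
Proof. by case: z w => x y [u v]; case: b. Qed.

Lemma part_cintegral b (u : R * R -> R[i]) :
  part b (cintegral U u) = I (part b \o u).
Proof. by case: b. Qed.

Lemma integral_part_sqr_le b (u : plane -> R[i]) :
  measurable_fun U (part true \o u) -> measurable_fun U (part false \o u) ->
  (\int[mu]_(x in U) (part b (u x) ^+ 2)%:E <= sq_L2norm U u)%E.
Proof.
move=> mr mi; apply: ge0_le_integral => //.
- by move=> x _; rewrite lee_fin sqr_ge0.
- by apply/measurable_EFinP; apply: measurable_funX; case: b.
- by apply/measurable_EFinP; apply: measurable_funD; exact: measurable_funX.
- by move=> x _; rewrite lee_fin part_sqr_le.
Qed.

Lemma real_L2_part b (u : plane -> R[i]) : in_L2 U u -> real_L2 U (part b \o u).
Proof.
move=> [mr mi u2]; split; first by case: b.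
apply/integrableP; split.
  by apply/measurable_EFinP; apply: measurable_funX; case: b.
apply: le_lt_trans u2; apply: le_trans (integral_part_sqr_le b mr mi).
rewrite le_eqVlt; apply/orP; left; apply/eqP; apply: eq_integral => x _.
by rewrite /= ger0_norm// sqr_ge0.
Qed.

Section Weak.
Variables (lambda : R) (psi g1 g2 : R * R -> R[i]).
Hypotheses (Lpsi : in_L2 U psi) (Lg1 : in_L2 U g1) (Lg2 : in_L2 U g2).
Hypotheses (dg1 : weak_derivative U (e1 R) psi g1)
  (dg2 : weak_derivative U (e2 R) psi g2).
Hypothesis lap : weak_laplacian U psi (fun x => - (real_complex R lambda * psi x)).

Lemma weak_derivative_part b v (u g : R * R -> R[i]) (chi : R * R -> R) :
  weak_derivative U v u g -> real_test U chi ->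
  I (fun x => part b (u x) * 'D_v chi x) = - I (fun x => part b (g x) * chi x).
Proof.
move=> /(_ _ (real_test_complex _)) w tchi; have := congr1 (part b) (w _ tchi).
rewrite partN !part_cintegral => h.
transitivity (I (part b \o
    (fun x => u x * cderive v (fun y => real_complex R (chi y)) x))).
  by apply: eq_Rintegral => x _; rewrite /comp cderive_real part_mul_real.
rewrite h; congr (- _); apply: eq_Rintegral => x _.
by rewrite /comp part_mul_real.
Qed.

(** The first derivatives of a test function are test functions, so the weak
    definition of [g1] and [g2] moves one derivative off the Laplacian. *)
Lemma weak_form_part b (chi : R * R -> R) : real_test U chi ->
  I (fun x => part b (g1 x) * 'D_(e1 R) chi x + part b (g2 x) * 'D_(e2 R) chi x)
  = lambda * I (fun x => part b (psi x) * chi x).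
Proof.
move=> tchi; have t1 := real_test_derive1 tchi; have t2 := real_test_derive2 tchi.
have Lp := real_L2_part b Lpsi.
have Lh1 := real_L2_part b Lg1.
have Lh2 := real_L2_part b Lg2.
have int1 := integrable_real_L2M mU Lp (real_L2_test mU (real_test_derive1 t1)).
have int2 := integrable_real_L2M mU Lp (real_L2_test mU (real_test_derive2 t2)).
have inth1 := integrable_real_L2M mU Lh1 (real_L2_test mU t1).
have inth2 := integrable_real_L2M mU Lh2 (real_L2_test mU t2).
have intp := integrable_real_L2M mU Lp (real_L2_test mU tchi).
have E1 := weak_derivative_part b dg1 t1; have E2 := weak_derivative_part b dg2 t2.
have lapE x : part b (psi x * claplacian (fun y => real_complex R (chi y)) x) =
    part b (psi x) * 'D_(e1 R) ('D_(e1 R) chi) x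
    + part b (psi x) * 'D_(e2 R) ('D_(e2 R) chi) x.
  have E v : cderive v (fun y => real_complex R (chi y)) =
      (fun y => real_complex R ('D_v chi y)) by apply/funext => y; exact: cderive_real.
  by rewrite /claplacian !E !cderive_real -rmorphD part_mul_real mulrDr.
have lapI := congr1 (part b) (lap (real_test_complex tchi)).
rewrite !part_cintegral in lapI.
rewrite (RintegralD mU inth1 inth2).
(* The second derivatives are generalized before computing: unification would
   otherwise unfold them. *)
have combine (q1 q2 : plane -> R) (r1 r2 : R) :
    intU (fun x => part b (psi x) * q1 x) -> intU (fun x => part b (psi x) * q2 x) ->
    I (fun x => part b (psi x) * q1 x) = - r1 ->
    I (fun x => part b (psi x) * q2 x) = - r2 ->
    (forall x, part b (psi x * claplacian (fun y => real_complex R (chi y)) x) =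
      part b (psi x) * q1 x + part b (psi x) * q2 x) ->
    r1 + r2 = lambda * I (fun x => part b (psi x) * chi x).
  move=> intq1 intq2 q1E q2E qE.
  transitivity (- (I (fun x => part b (psi x) * q1 x + part b (psi x) * q2 x))).
    by rewrite (RintegralD mU intq1 intq2) q1E q2E opprD !opprK.
  transitivity (- (- lambda * I (fun x => part b (psi x) * chi x))); last first.
    by rewrite mulNr opprK.
  congr (- _); rewrite -(RintegralZl _ mU intp).
  transitivity (I (part b \o
      (fun x => psi x * claplacian (fun y => real_complex R (chi y)) x))).
    by apply: eq_Rintegral => x _; rewrite -qE.
  rewrite lapI; apply: eq_Rintegral => x _.
  by rewrite /comp part_mul_real partN (mulrC (real_complex _ _)) part_mul_real; ring.
exact: (combine _ _ _ _ int1 int2 E1 E2 lapE).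
Qed.

Lemma real_approx b (phi u : plane -> R[i]) : in_L2 U u ->
  real_L2 U (part true \o phi) -> real_L2 U (part false \o phi) ->
  ((I (fun x => (part b (phi x) - part b (u x)) ^+ 2))%:E
    <= sq_L2norm U (fun x => (phi x - u x)%R))%E.
Proof.
move=> Lu Lr Li.
have Lpart c : real_L2 U (part c \o (fun x => (phi x - u x)%R)).
  have -> : part c \o (fun x => (phi x - u x)%R) =
      (fun x => (part c \o phi) x - (part c \o u) x).
    by apply/funext => x; exact: partB.
  by apply: real_L2_sub => //; [case: c|exact: real_L2_part].
apply: le_trans (integral_part_sqr_le b (Lpart true).1 (Lpart false).1).
rewrite le_eqVlt; apply/orP; left; apply/eqP.
rewrite [LHS]fineK; last first.
  apply: integrable_fin_num => //.
  have [_] := Lpart b; rewrite /comp.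
  by under eq_fun do rewrite partB.
by apply: eq_integral => x _; rewrite partB.
Qed.

End Weak.

End ComplexParts.

Lemma open_broken_guide (R : realType) (theta : R) : open (broken_guide theta).
Proof.
pose f (x : R * R) := `|x.2| - x.1 * tan theta.
pose g (x : R * R) := (x.1 + pi / sin theta) * tan theta - `|x.2|.
have -> : broken_guide theta = f @^-1` [set` `]0, +oo[] `&` g @^-1` [set` `]0, +oo[].
  apply/seteqP; split=> x; rewrite /broken_guide /f /g /= !in_itv/= !andbT !subr_gt0.
    by move=> /andP.
  by move=> [-> ->].
have c1 : continuous (fun x : R * R => x.1) by move=> x; exact: cvg_fst.
have c2 : continuous (fun x : R * R => `|x.2|).
  by move=> x; apply: cvg_norm; exact: cvg_snd.
apply: openI; apply: open_comp; try exact: interval_open.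
- by move=> x _; apply: cvgB; [exact: c2|apply: cvgM; [exact: c1|exact: cvg_cst]].
- move=> x _; apply: cvgB; last exact: c2.
  apply: cvgM; last exact: cvg_cst.
  by apply: cvgD; [exact: c1|exact: cvg_cst].
Qed.

Lemma broken_guide_mirror (R : realType) (theta : R) x :
  broken_guide theta x -> broken_guide theta (mirror x).
Proof. by rewrite /broken_guide /mirror/= normrN. Qed.

Theorem mainTheorem7 (R : realType) (theta : R) (htheta : 0 < theta < pi / 2)
    (lambda : R) (psi : R * R -> R[i])
    (hpsi : dirichlet_eigenvector (broken_guide theta) lambda psi)
    (hlambda : lambda < 1) :
  {ae @plane_measure R, forall x, broken_guide theta x ->
     psi (x.1, - x.2) = psi x}.
Proof.
have [_ [[g1 [g2 [[Lpsi Lg1 Lg2] dg1 dg2 approx]]] _ lap]] := hpsi.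
have mU := open_measurable_plane (@open_broken_guide R theta).
have sU := @broken_guide_mirror R theta.
have ae_part b : {ae @plane_measure R, forall x, broken_guide theta x ->
    part b (psi (mirror x)) = part b (psi x)}.
  have Lp := real_L2_part mU b Lpsi.
  have [_ intq] := real_L2_sub mU Lp (real_L2_mirror mU sU Lp).
  have q0 : \int[@plane_measure R]_(x in broken_guide theta)
      (part b (psi x) - part b (psi (mirror x))) ^+ 2 = 0.
    apply: (odd_part_eq0 mU sU hlambda (p := part b \o psi) (h1 := part b \o g1)
      (h2 := part b \o g2)) => //.
    - by move=> chi tchi chi_odd; exact: odd_poincare.
    - exact: real_L2_part.
    - exact: real_L2_part.
    - by move=> chi tchi; exact: (weak_form_part mU Lpsi Lg1 Lg2 dg1 dg2 lap).
    - move=> eps eps0.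
      have sqrt0 : 0 < Num.sqrt eps by rewrite sqrtr_gt0.
      have [phi tphi] := approx _ sqrt0; rewrite sqr_sqrtr ?ltW// => lt_eps.
      have tpart c := real_test_part c tphi.
      exists (part b \o phi); first exact: tpart.
      have Lphi c := real_L2_test mU (tpart c).
      have Lphi1 c : real_L2 (broken_guide theta) (part c \o cderive (e1 R) phi).
        have -> : part c \o cderive (e1 R) phi = 'D_(e1 R) (part c \o phi).
          by apply/funext => x; exact: part_cderive.
        exact: (real_L2_test mU (real_test_derive1 (tpart c))).
      have Lphi2 c : real_L2 (broken_guide theta) (part c \o cderive (e2 R) phi).
        have -> : part c \o cderive (e2 R) phi = 'D_(e2 R) (part c \o phi).
          by apply/funext => x; exact: part_cderive.
        exact: (real_L2_test mU (real_test_derive2 (tpart c))).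
      rewrite -lee_fin !EFinD; apply: le_trans (ltW lt_eps).
      apply: leeD; first apply: leeD.
      + exact: (real_approx mU b Lpsi (Lphi true) (Lphi false)).
      + have := real_approx mU b Lg1 (Lphi1 true) (Lphi1 false).
        by under eq_Rintegral do rewrite part_cderive.
      + have := real_approx mU b Lg2 (Lphi2 true) (Lphi2 false).
        by under eq_Rintegral do rewrite part_cderive.
  have mq : measurable_fun (broken_guide theta)
      (EFin \o (fun x => (part b (psi x) - part b (psi (mirror x))) ^+ 2)).
    by case/integrableP : intq.
  have /(ae_eq_integral_abs _ mU mq) : (\int[@plane_measure R]_(x in broken_guide theta)
      `|(EFin \o (fun x =>
        ((part b (psi x) - part b (psi (mirror x))) ^+ 2)%R)) x| = 0)%E.
    transitivity (\int[@plane_measure R]_(x in broken_guide theta)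
        ((part b (psi x) - part b (psi (mirror x))) ^+ 2)%:E)%E.
      by apply: eq_integral => x _; rewrite /= ger0_norm// sqr_ge0.
    rewrite -[LHS]fineK; first by congr EFin; exact: q0.
    exact: (integrable_fin_num mU intq).
  apply: filterS => x /[apply] /= -[] /eqP.
  by rewrite sqrf_eq0 subr_eq0 => /eqP.
have [aeR aeI] := (ae_part true, ae_part false).
have aeF := ae_filter_ringOfSetsType (@plane_measure R).
apply: (@filterS _ _ aeF _ _ _ (@filterI _ _ aeF _ _ aeR aeI)) => x [xR xI] Ux.
apply/eqP; rewrite eq_complex; apply/andP.
by split; apply/eqP; [exact: xR Ux|exact: xI Ux].
Qed.
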